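(* Let $m\ge 1$ be an integer and let $k\in\mathbb{Z}$. The sequence $$a(n,2m,k)=\sum_{j\in\mathbb{Z}}(-1)^j\binom{n}{\left\lfloor\frac{n-2mj+k}{2}\right\rfloor},\qquad n\in\mathbb{N},$$ satisfies the recurrence relation $$L_m(E,-1)\,a(n,2m,k)=0\quad\text{for all } n\in\mathbb{N}.$$
   Context: $\mathbb{N}=\{0,1,2,\dots\}$. For $n\in\mathbb{N}$ and $i\in\mathbb{Z}$, $\binom{n}{i}$ is the usual binomial coefficient, equal to $0$ if $i<0$ or $i>n$; hence the sum over $j$ has only finitely many nonzero terms. $\lfloor\cdot\rfloor$ is the floor function. The Lucas polynomials $L_n(x,s)$ are defined by $L_0(x,s)=2$, $L_1(x,s)=x$ and $L_n(x,s)=xL_{n-1}(x,s)+sL_{n-2}(x,s)$ for $n\ge2$; for $n\ge1$, $L_n(x,s)=\sum_{k=0}^{n-1}\binom{n-k}{k}\frac{n}{n-k}s^kx^{n-2k}$ (terms with zero binomial coefficient being omitted). $E$ is the shift operator in the variable $n$: for a polynomial $p(x)=\sum_{i=0}^{d}a_ix^i$ and a function $f$ of $n\in\mathbb{N}$ (possibly depending on further parameters, which are kept fixed), $p(E)f(n)=\sum_{i=0}^{d}a_if(n+i)$. Here $L_m(E,-1)$ denotes $p(E)$ for $p(x)=L_m(x,-1)$. *)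

(* Defs.v *)
From HB Require Import structures.
From mathcomp Require Import all_boot all_order all_algebra.
From mathcomp Require Import boolp classical_sets functions cardinality fsbigop.
From mathcomp Require Import zify.

Set Implicit Arguments.
Unset Strict Implicit.
Unset Printing Implicit Defensive.

Import Order.TTheory GRing.Theory Num.Theory.
Local Open Scope ring_scope.

(* The polynomial L_n(x, s) evaluated at elements of an arbitrary commutative
   ring; in particular [lucas 'X (-1) n : {poly int}] is L_n(x, -1) as a
   polynomial in x. *)
Fixpoint lucas (R : comNzRingType) (x s : R) (n : nat) : R :=
  match n with
  | 0 => 2%:R
  | n'.+1 =>
    match n' with
    | 0 => x
    | n''.+1 => x * lucas x s n' + s * lucas x s n''
    end
  end.

(* p(E) f, with E the shift f |-> f (_ + 1). *)
Definition shift_op (R : comNzRingType) (p : {poly R}) (f : nat -> R)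
  (n : nat) : R := \sum_(i < size p) p`_i * f (n + i)%N.

Definition binz (n : nat) (i : int) : int :=
  match i with
  | Posz i' => ('C(n, i'))%:Z
  | Negz _ => 0
  end.

(* [%/ 2] on int rounds down, so it is the floor. *)
Definition binsum_term (n r : nat) (k j : int) : int :=
  (-1) ^ j * binz n ((n%:Z - r%:Z * j + k) %/ 2)%Z.

(* The sum has finite support for r > 0, see [binsum_term_finite]; like every
   finitely supported sum over a set, it is 0 by convention otherwise. *)
Definition binsum (n r : nat) (k : int) : int :=
  \sum_(j \in [set: int]%classic) binsum_term n r k j.

Lemma binz_neq0 (n : nat) (i : int) : binz n i != 0 -> 0 <= i <= n%:Z.
Proof.
case: i => [i|i] //=.
by rewrite lez_nat; case: leqP => // /bin_small ->.
Qed.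

Lemma binsum_term_finite (n r : nat) (k : int) : (0 < r)%N ->
  finite_set [set j | binsum_term n r k j != 0]%classic.
Proof.
move=> r0.
pose N := (4 * n + 2 * `|k| + 4)%N.
apply: (@sub_finite_set _ _
  [set` [seq (i%:Z - N%:Z) | i <- iota 0 (2 * N).+1]]%classic); last first.
  exact: finite_seq.
move=> /= j; rewrite /binsum_term mulf_eq0 negb_or => /andP[_ /binz_neq0 h].
have [h1 h2] : - N%:Z <= j /\ j <= N%:Z.
  have := divz_eq (n%:Z - r%:Z * j + k) 2.
  have := ltz_pmod (n%:Z - r%:Z * j + k) (isT : (0 < 2 :> int)).
  have := modz_ge0 (n%:Z - r%:Z * j + k) (isT : (2 != 0 :> int)).
  move: h; rewrite /N; nia.
have -> : j = (absz (j + N%:Z))%:Z - N%:Z by lia.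
apply: (@map_f _ _ (fun i : nat => i%:Z - N%:Z) (iota 0 (2 * N).+1)).
by rewrite mem_iota; lia.
Qed.

(* Main.v *)
(* By Pascal's rule the shift E in n acts on b(n, k) = binom(n, floor((n + k)/2))
   as K + K^-1, where K is the shift in k. Since L_m(x + x^-1, -1) = x^m + x^-m,
   the operator L_m(E, -1) acts on a(n, 2m, k), an alternating sum of translates
   of b in k, as K^m + K^-m. This is zero because a(n, 2m, k + 2m) = - a(n, 2m, k). *)
Require Import Defs.
From mathcomp Require Import all_boot all_order all_algebra.
From mathcomp Require Import classical_sets cardinality fsbigop.
From mathcomp Require Import zify ring.
Set Implicit Arguments.
Unset Strict Implicit.
Unset Printing Implicit Defensive.
Import Order.TTheory GRing.Theory Num.Theory.
Local Open Scope ring_scope.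

Section ShiftOp.
Variable R : comNzRingType.
Implicit Types (p q : {poly R}) (f : nat -> R) (g : nat -> int -> R).

(** Zero padding gives polynomials of different sizes a common summation range; in a difference the
    leading terms may cancel, so sizes alone do not match. *)
Lemma shift_op_wide N p f n : (size p <= N)%N ->
  shift_op p f n = \sum_(i < N) p`_i * f (n + i)%N.
Proof.
move=> le_pN; rewrite /shift_op.
rewrite (big_ord_widen N (fun i => p`_i * f (n + i)%N)) // big_mkcond.
apply: eq_bigr => i _; case: ltnP => // le_pi.
by rewrite nth_default ?mul0r.
Qed.

Lemma shift_opC c f n : shift_op c%:P f n = c * f n.
Proof.
by rewrite (@shift_op_wide 1) ?size_polyC_leq1 // big_ord1 coefC eqxx addn0.
Qed.

Lemma shift_opB p q f n :
  shift_op (p - q) f n = shift_op p f n - shift_op q f n.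
Proof.
set N := maxn (size p) (size q).
have le_pqN : (size (p - q)%R <= N)%N.
  by rewrite (leq_trans (size_polyD _ _)) // size_polyN.
rewrite !(@shift_op_wide N) ?leq_maxl ?leq_maxr //.
by rewrite -sumrB; apply: eq_bigr => i _; rewrite coefB mulrBl.
Qed.

Lemma shift_opXM p f n : shift_op ('X * p) f n = shift_op p f n.+1.
Proof.
rewrite (@shift_op_wide (size p).+1); last first.
  by rewrite mulrC (leq_trans (size_polyMleq _ _)) // size_polyX addn2.
rewrite big_ord_recl coefXM mul0r add0r; apply: eq_bigr => i _.
by rewrite coefXM lift0 addSnnS.
Qed.

Lemma shift_op_lucas g :
  (forall n k, g n.+1 k = g n (k + 1) + g n (k - 1)) ->
  forall m n k, shift_op (lucas 'X (-1) m) (g^~ k) n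
                = g n (k + m%:Z) + g n (k - m%:Z).
Proof.
move=> gS m.
(* The recurrence has order two, so the induction carries two consecutive indices; [n] stays general
   because ['X] moves it to [n.+1]. *)
suff: forall n k, (shift_op (lucas 'X (-1) m) (g^~ k) n
                    = g n (k + m%:Z) + g n (k - m%:Z)) /\
                  (shift_op (lucas 'X (-1) m.+1) (g^~ k) n
                    = g n (k + m.+1%:Z) + g n (k - m.+1%:Z)).
  by move=> H n k; case: (H n k).
elim: m => [|m IHm] n k.
  split; first by rewrite /= -polyC_natr shift_opC subr0 mulr_natl mulr2n.
  by rewrite /= -['X]mulr1 shift_opXM shift_opC mul1r gS.
split; first by case: (IHm n k).
have -> : lucas 'X (-1) m.+2
    = 'X * lucas 'X (-1) m.+1 - lucas 'X (-1) m :> {poly R}.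
  by rewrite /= mulN1r.
rewrite shift_opB shift_opXM.
(* Expanding the two terms at [n.+1] by [gS] gives shifts by [m.+2] and by [m] in both directions;
   the latter cancel against the subtracted [lucas 'X (-1) m]. *)
have [-> _] := IHm n k; have [_ ->] := IHm n.+1 k; rewrite !gS.
have -> : k + m.+1%:Z + 1 = k + m.+2%:Z by lia.
have -> : k + m.+1%:Z - 1 = k + m%:Z by lia.
have -> : k - m.+1%:Z + 1 = k - m%:Z by lia.
have -> : k - m.+1%:Z - 1 = k - m.+2%:Z by lia.
ring.
Qed.

End ShiftOp.

Lemma binzS n i : binz n.+1 i = binz n i + binz n (i - 1).
Proof.
case: i => [[|i]|i]; [by rewrite /= !bin0 | | by []].
have -> : i.+1%:Z - 1 = i%:Z by lia.
by rewrite /= binS PoszD.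
Qed.

(** Pascal's rule lowers the bottom index by 1, which under the floor of a half means lowering
    [k + 1] by 2, to [k - 1]. *)
Lemma binsum_termS n r k j :
  binsum_term n.+1 r k j = binsum_term n r (k + 1) j + binsum_term n r (k - 1) j.
Proof.
rewrite /binsum_term binzS mulrDr.
have -> : n.+1%:Z - r%:Z * j + k = n%:Z - r%:Z * j + (k + 1) by lia.
congr (_ + _ * binz n _).
have -> : n%:Z - r%:Z * j + (k + 1) = 1 * 2 + (n%:Z - r%:Z * j + (k - 1)).
  by ring.
by rewrite divzMDl // addrC addKr.
Qed.

Lemma binsumS n r k : (0 < r)%N ->
  binsum n.+1 r k = binsum n r (k + 1) + binsum n r (k - 1).
Proof.
move=> r_gt0.
(* A finite set containing the supports of all three sums, on which they can be split termwise. *)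
set D := ([set j | binsum_term n r (k + 1) j != 0] `|`
          [set j | binsum_term n r (k - 1) j != 0])%classic.
have finD : finite_set D by rewrite finite_setU; split; exact: binsum_term_finite.
have notD j : ~ D j ->
    binsum_term n r (k + 1) j = 0 /\ binsum_term n r (k - 1) j = 0.
  by move=> Dj; split; apply/eqP/negPn/negP => nz; apply: Dj; [left|right].
rewrite /binsum -!(@fsbig_widen _ _ _ _ D) //.
- by rewrite -fsbig_split //; apply: eq_fsbigr => j _; rewrite /= binsum_termS.
- by move=> j [_ /notD[]].
- by move=> j [_ /notD[]].
- by move=> j [_ /notD[h1 h2]]; rewrite /= binsum_termS h1 h2.
Qed.

(** Substituting [j + 1] for [j] absorbs the shift of [k] by [r] and flips the sign [(-1) ^ j]. *)
Lemma binsum_antiperiodic n r k : binsum n r (k + r%:Z) = - binsum n r k.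
Proof.
have bij_succ : bijective (fun j : int => j + 1).
  by exists (fun j => j - 1) => j; rewrite ?addrK ?subrK.
rewrite /binsum (reindex_fsbigT _ _ bij_succ) -mulN1r mulr_fsumr.
apply: eq_fsbigr => j _; rewrite /binsum_term exprzDr // expr1z mulrN1 mulN1r mulNr.
by congr (- (_ * binz n (_ %/ _)%Z)); ring.
Qed.

Theorem theorem2 (m : nat) (k : int) (hm : (1 <= m)%N) :
  forall n : nat,
    shift_op (lucas ('X : {poly int}) (-1) m) (fun i => binsum i (2 * m) k) n
      = 0.
Proof.
move=> n.
have r_gt0 : (0 < 2 * m)%N by lia.
rewrite (shift_op_lucas (g := fun i => binsum i (2 * m))); last first.
  by move=> i l; exact: binsumS.
(* The two translates [k + m] and [k - m] lie exactly one antiperiod [2 * m] apart. *)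
have -> : k + m%:Z = k - m%:Z + (2 * m)%N%:Z by lia.
by rewrite binsum_antiperiodic addNr.
Qed.
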